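(* Let $U$ be an $N\times N$ unitary matrix. If its defect satisfies $\mathbf d(U)=0$, then $U$ is isolated.
   Context: Let $f$ be the map sending a complex $N\times N$ matrix $U$ to the real matrix $(|U_{i,j}|^2)_{i,j}$, regarded as a smooth map between real vector spaces, with differential at $U$ given by $Df_U(V)=\big(2\,\mathrm{Re}(\overline{U_{i,j}}V_{i,j})\big)_{i,j}$. For an $N\times N$ unitary matrix $U$ let $T_U=\{EU: E\in\mathbb C^{N\times N},\ E^*=-E\}$ be the (real) tangent space at $U$ to the manifold of unitary matrices. The defect of $U$ is the integer $\mathbf d(U)=(N-1)^2-\dim_{\mathbb R}Df_U(T_U)$. An $N\times N$ unitary matrix $U$ is called isolated if there is a neighbourhood $\mathcal W$ of $U$ in the space of complex $N\times N$ matrices (identified with $\mathbb R^{2N^2}$) such that the unitary matrices $V\in\mathcal W$ with $|V_{i,j}|=|U_{i,j}|$ for all $i,j$ are exactly the elements of $\mathcal W\cap\{D_rUD_c: D_r,D_c \text{ unitary diagonal}\}$. *)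

(* Defs.v *)
From HB Require Import structures.
From mathcomp Require Import all_boot all_order all_algebra ring.
From mathcomp Require Import spectral complex.
From mathcomp Require Import all_classical all_reals all_analysis.

Set Implicit Arguments.
Unset Strict Implicit.
Unset Printing Implicit Defensive.

Import Order.TTheory GRing.Theory Num.Theory.
Import numFieldNormedType.Exports.

Local Open Scope classical_set_scope.
Local Open Scope sesquilinear_scope.
Local Open Scope ring_scope.

(* R[i] packaged as a numClosedFieldType: MathComp-Analysis puts the norm
   topology on the carrier of such a structure, but not on R[i] itself. *)
Definition Cplx (R : realType) : numClosedFieldType := R[i].

Section RealDim.
Context {R : realType} {vT : vectType R}.

(* Meaningful only when A is (the carrier of) a linear subspace; the default
   value 0%VS is used otherwise. *)
Definition real_dim (A : set vT) : nat :=
  \dim (xget 0%VS [set W : {vspace vT} | [set x | x \in W] = A]).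

Lemma real_dimE (A : set vT) (W : {vspace vT}) :
  (forall x, x \in W <-> A x) -> real_dim A = \dim W.
Proof.
move=> WA; rewrite /real_dim; case: xgetP => [W' _ /= W'A|/(_ W)/=]; last first.
  by case; apply/seteqP; split => x /= /WA.
congr (\dim _); apply/vspaceP => x; apply/idP/idP.
  by move=> xW'; apply/WA; rewrite -W'A.
by move=> /WA; rewrite -W'A.
Qed.

Lemma real_dim_submod (A : set vT) : A 0 ->
    (forall (a : R) x y, A x -> A y -> A (a *: x + y)) ->
  exists2 W : {vspace vT}, forall x, x \in W <-> A x & real_dim A = \dim W.
Proof.
move=> A0 Alin.
pose P n := `[<exists2 W : {vspace vT}, forall x, x \in W -> A x & \dim W = n>].
have exP : exists n, P n.
  exists 0%N; apply/asboolP; exists 0%VS; last exact: dimv0.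
  by move=> x; rewrite memv0 => /eqP ->.
have ubP n : P n -> (n <= \dim {:vT})%N.
  by move=> /asboolP[W _ <-]; exact/dimvS/subvf.
case: (ex_maxnP exP ubP) => n /asboolP[W WA dimW] nmax.
suff AW x : x \in W <-> A x by exists W => //; exact: real_dimE.
split=> [|Ax]; first exact: WA.
have: P (\dim (<[x]> + W)%VS).
  apply/asboolP; exists (<[x]> + W)%VS => // y /memv_addP[_ /vlineP[a ->]].
  by move=> [w wW ->]; apply: Alin => //; exact: WA.
move=> /nmax; rewrite -dimW => dle.
have /eqP -> : W == (<[x]> + W)%VS by rewrite eqEdim addvSr.
by rewrite (subvP (addvSl _ _)) // memv_line.
Qed.

End RealDim.

Section Defect.
Context {R : realType} {N : nat}.
Implicit Types U V : 'M[Cplx R]_N.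

Definition sqnorm_mx U : 'M[R]_N := \matrix_(i, j) complex.Re (`|U i j| ^+ 2).

Definition Dsqnorm_mx U V : 'M[R]_N :=
  \matrix_(i, j) (2 * complex.Re ((U i j)^* * V i j)).

(* As sqnorm_mx is quadratic, this exact expansion shows that Dsqnorm_mx U is
   its differential at U. *)
Lemma sqnorm_mxD U V :
  sqnorm_mx (U + V) = sqnorm_mx U + Dsqnorm_mx U V + sqnorm_mx V.
Proof.
apply/matrixP => i j; rewrite !mxE !normCK.
case: (U i j) (V i j) => [a b] [c d] /=.
by rewrite !mulrDl !mulrDr !mulrN !mulNr !opprK; ring.
Qed.

Definition unitary_tangent U : set 'M[Cplx R]_N :=
  [set E *m U | E in [set E : 'M[Cplx R]_N | E ^t* = - E]].

Definition defect U : int :=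
  (N%:Z - 1) ^+ 2 - (real_dim (Dsqnorm_mx U @` unitary_tangent U))%:Z.

Lemma defect_subspace U :
  exists2 W : {vspace 'M[R]_N},
    forall M, M \in W <-> (Dsqnorm_mx U @` unitary_tangent U) M &
    defect U = (N%:Z - 1) ^+ 2 - (\dim W)%:Z.
Proof.
rewrite /defect; set A := _ @` _.
have A0 : A 0.
  exists 0; first by exists 0; rewrite /= ?mul0mx// trmx0 map_mx0 oppr0.
  by apply/matrixP => i j; rewrite !mxE mulr0 /= mulr0.
have Alin (a : R) x y : A x -> A y -> A (a *: x + y).
  move=> [_ [E /= Eh <-] <-] [_ [F /= Fh <-] <-].
  have ac : ((a%:C)%C : Cplx R)^* = (a%:C)%C.
    by rewrite /Num.conj /= oppr0.
  exists (((a%:C)%C : Cplx R) *: (E *m U) + F *m U).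
    exists (((a%:C)%C : Cplx R) *: E + F); last by rewrite mulmxDl scalemxAl.
    rewrite /= linearD linearZ /= map_mxD map_mxZ Eh Fh; rewrite [X in X *: _]ac.
    by rewrite scalerN opprD.
  apply/matrixP => i j; rewrite !mxE.
  move: (U i j) (\sum_k _) (\sum_k _) => [u1 u2] [e1 e2] [f1 f2] /=.
  by rewrite !mulNr !opprK; ring.
by have [W WA ->] := real_dim_submod A0 Alin; exists W.
Qed.

Definition unitary_diag (D : 'M[Cplx R]_N) : bool :=
  (D \is unitarymx) && is_diag_mx D.

Definition isolated_unitary U : Prop :=
  exists2 W : set 'M[Cplx R]_N, nbhs U W &
    W `&` [set V | V \is unitarymx /\ forall i j, `|V i j| = `|U i j|] =
    W `&` [set V : 'M[Cplx R]_N | exists Dr Dc : 'M[Cplx R]_N,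
             [/\ unitary_diag Dr, unitary_diag Dc & V = Dr *m U *m Dc]].

End Defect.

(* Main.v *)
(* Let V be unitary with |V_ij| = |U_ij|, and multiply it by unitary diagonal
   matrices so as to maximize Re tr(V U^* ). The distance to U does not
   grow, and at the maximum the row and column sums of conj(U_ij) V_ij are
   real, that is, W = V - U is orthogonal to the gauge directions i(D_r U +
   U D_c). The matrix E = W U^* + W W^* / 2 is exactly antihermitian and,
   since 2 Re(conj(U_ij) W_ij) = - |W_ij|^2, the tangent vector E U solves
   the linearized equations and the gauge conditions up to O(|W|^2). When
   the defect is 0 the image of Df_U is the space of all real matrices with
   zero row and column sums. Hence U has no zero entry (if N > 1), so the
   gauge directions have dimension 2N - 1 and exhaust the kernel of Df_U on
   T_U. The linear system is therefore injective, so |W| <= C |W|^2, and W =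
   0 when V is close to U. *)

Require Import Defs.
From HB Require Import structures.
From mathcomp Require Import all_boot all_order all_algebra.
From mathcomp Require Import spectral complex.
From mathcomp Require Import all_classical all_reals all_analysis.
From mathcomp Require Import ring lra zify.

Set Implicit Arguments.
Unset Strict Implicit.
Unset Printing Implicit Defensive.

Import Order.TTheory GRing.Theory Num.Theory.
Import numFieldNormedType.Exports.

Local Open Scope classical_set_scope.
Local Open Scope sesquilinear_scope.
Local Open Scope ring_scope.
Local Notation re z := (complex.Re (z : Cplx _)).
Local Notation im z := (complex.Im (z : Cplx _)).

Lemma continuous_sum (K : numFieldType) (T : topologicalType)
    (V : normedModType K) (I : Type) (s : seq I) (f : I -> T -> V) :
  (forall i, continuous (f i)) -> continuous (fun x => \sum_(i <- s) f i x).
Proof.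
move=> cf; elim: s => [|i s IHs] x.
  rewrite (_ : (fun _ => _) = fun=> 0); first exact: cvg_cst.
  by apply/funext => y; rewrite big_nil.
rewrite (_ : (fun _ => _) = fun y => f i y + \sum_(j <- s) f j y).
  by apply: cvgD; [exact: cf|exact: IHs].
by apply/funext => y; rewrite big_cons.
Qed.

(** * Maximization over row and column phases *)

Section Phases.
Context {R : realType}.
Implicit Types (t : R) (u z : Cplx R).

Lemma re_sum (I : Type) (s : seq I) (F : I -> Cplx R) :
  re (\sum_(i <- s) F i) = \sum_(i <- s) re (F i).
Proof. exact: (raddf_sum (@complex.Re R)). Qed.

Lemma im_sum (I : Type) (s : seq I) (F : I -> Cplx R) :
  im (\sum_(i <- s) F i) = \sum_(i <- s) im (F i).
Proof. exact: (raddf_sum (@complex.Im R)). Qed.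

Definition cis t : Cplx R := (cos t +i* sin t)%C.

Lemma sqr_normE z :
  `|z| ^+ 2 = ((re z ^+ 2 + im z ^+ 2)%:C)%C :> Cplx R.
Proof. by rewrite (add_Re2_Im2 z). Qed.

Lemma norm1E z : `|z| = 1 -> re z ^+ 2 + im z ^+ 2 = 1.
Proof.
by move=> z1; have := sqr_normE z; rewrite z1 expr1n => -[<-].
Qed.

Lemma norm_cis t : `|cis t| = 1.
Proof.
by apply/eqP; rewrite -sqrp_eq1 ?normr_ge0// sqr_normE /= cos2Dsin2.
Qed.

Lemma cis_surj u : `|u| = 1 -> exists2 t, t \in `[- pi, pi]%R & u = cis t.
Proof.
move=> /norm1E; case: u => a b /= ab1.
have a1 : -1 <= a <= 1 by apply/andP; split; nra.
have [/andP[t0 tpi] cost] := acos_def a1.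
have sint : sin (acos a) = `|b|.
  by rewrite sin_acos// -ab1 addrAC subrr add0r sqrtr_sqr.
have [b0|b0] := leP 0 b.
  exists (acos a); first by rewrite in_itv /= tpi andbT; lra.
  by rewrite /cis cost sint ger0_norm.
exists (- acos a); first by rewrite in_itv /= lerN2 tpi /=; lra.
by rewrite /cis cosN sinN cost sint ltr0_norm// opprK.
Qed.

(** For [z != 0], the test phase [u = |z| / z] gives [|z| <= re z], which leaves no room for an
    imaginary part. *)
Lemma Im0_of_Re_max z : (forall u, `|u| = 1 -> re (u * z) <= re z) ->
  im z = 0.
Proof.
move=> zmax; have [->//|z0] := eqVneq z 0.
have nz0 : `|z| != 0 by rewrite normr_eq0.
have /zmax : `| `|z| / z | = 1 by rewrite normf_div normr_id divff.
rewrite divfK// (normc_def z) /=.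
case: (z) => x y /=; set a := Num.sqrt _ => ax.
have a0 : 0 <= a := sqrtr_ge0 _.
have : a ^+ 2 = x ^+ 2 + y ^+ 2 by rewrite sqr_sqrtr// addr_ge0 ?sqr_ge0.
nra.
Qed.

(** For [M i j = V i j * (U i j)^*] this is the trace of [D_r V D_c U^*], where [D_r] and [D_c] are
    diagonal with entries [r] and [c]. *)
Definition phase_sum m n (M : 'M[Cplx R]_(m, n)) (r : 'I_m -> Cplx R)
  (c : 'I_n -> Cplx R) : Cplx R := \sum_i \sum_j r i * (c j * M i j).

Lemma phase_sumC m n (M : 'M[Cplx R]_(m, n)) r c :
  phase_sum M r c = phase_sum M^T c r.
Proof.
rewrite /phase_sum exchange_big; apply: eq_bigr => j _; apply: eq_bigr => i _.
by rewrite mxE mulrCA.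
Qed.

(** Extreme value theorem on the compact cube of angles in [[-pi, pi]]; every family of phases comes
    from a point of this cube. *)
Lemma phase_sum_max n (M : 'M[Cplx R]_n) :
  exists r c : 'I_n -> Cplx R,
    [/\ forall i, `|r i| = 1, forall j, `|c j| = 1 &
     forall r' c', (forall i, `|r' i| = 1) -> (forall j, `|c' j| = 1) ->
      re (phase_sum M r' c') <= re (phase_sum M r c)].
Proof.
pose r (x : 'rV[R]_(n + n)) i := cis (x 0 (lshift n i)).
pose c (x : 'rV[R]_(n + n)) j := cis (x 0 (rshift n j)).
pose F x := re (phase_sum M (r x) (c x)).
pose A : set 'rV[R]_(n + n) :=
  [set x | forall i, `[- pi, pi]%classic (x ord0 i)].
have cA : compact A.
  exact: (@rV_compact R (n + n) (fun=> `[- pi, pi]%classic) (fun=>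
    @segment_compact R _ _)).
have A0 : A !=set0.
  by exists 0 => i /=; rewrite mxE in_itv /= oppr_le0 !pi_ge0.
(* Written in sines and cosines of the coordinates, [F] is visibly continuous. *)
have FE x : F x = \sum_i \sum_j
    (cos (x 0 (lshift n i)) * cos (x 0 (rshift n j)) * re (M i j)
   - cos (x 0 (lshift n i)) * sin (x 0 (rshift n j)) * im (M i j)
   - sin (x 0 (lshift n i)) * cos (x 0 (rshift n j)) * im (M i j)
   - sin (x 0 (lshift n i)) * sin (x 0 (rshift n j)) * re (M i j)).
  rewrite /F /phase_sum re_sum; apply: eq_bigr => i _.
  rewrite re_sum; apply: eq_bigr => j _.
  by case: (M i j) => a b /=; ring.
have cosF k : continuous (fun x : 'rV[R]_(n + n) => cos (x 0 k)).
  move=> x; apply: (@continuous_comp _ _ _ (fun x : 'rV[R]_(n + n) => x 0 k)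
    cos).
    exact: coord_continuous.
  exact: continuous_cos.
have sinF k : continuous (fun x : 'rV[R]_(n + n) => sin (x 0 k)).
  move=> x; apply: (@continuous_comp _ _ _ (fun x : 'rV[R]_(n + n) => x 0 k)
    sin).
    exact: coord_continuous.
  exact: continuous_sin.
have mulF (f g : 'rV[R]_(n + n) -> R) (a : R) : continuous f -> continuous g ->
    continuous (fun x => f x * g x * a).
  by move=> cf cg x; apply: (cvgM (cvgM (cf x) (cg x)) (cvg_cst a)).
have subF (f g : 'rV[R]_(n + n) -> R) : continuous f -> continuous g ->
    continuous (fun x => f x - g x).
  by move=> cf cg x; apply: (cvgB (cf x) (cg x)).
have cF : continuous F.
  rewrite (funext FE); apply: continuous_sum => i; apply: continuous_sum => j.
  by apply: (subF); [apply: (subF); [apply: (subF)|]|]; apply: (mulF).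
have [x xA xmax] := EVT_max_rV A0 cA (continuous_subspaceT cF).
exists (r x), (c x); split=> [i|j|r' c' r'1 c'1]; try exact: norm_cis.
have /choice[tr trP] : forall i, exists t, t \in `[- pi, pi]%R /\ r' i = cis t.
  by move=> i; have [t] := cis_surj (r'1 i); exists t.
have /choice[tc tcP] : forall j, exists t, t \in `[- pi, pi]%R /\ c' j = cis t.
  by move=> j; have [t] := cis_surj (c'1 j); exists t.
pose y : 'rV[R]_(n + n) := row_mx (\row_i tr i) (\row_j tc j).
have -> : r' = r y.
  by apply/funext => i; rewrite /r row_mxEl mxE; case: (trP i).
have -> : c' = c y.
  by apply/funext => i; rewrite /c row_mxEr mxE; case: (tcP i).
apply: xmax; rewrite inE => i.
by case: (split_ordP i) => k ->; rewrite ?row_mxEl ?row_mxEr mxE;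
  [case: (trP k)|case: (tcP k)].
Qed.

(** Turning only the phase of row [i] by [u] leaves the other rows unchanged, so maximality reduces
    to [re (u * z) <= re z] for the sum [z] of that row. *)
Lemma phase_sum_max_row m n (M : 'M[Cplx R]_(m, n)) r c :
    (forall i, `|r i| = 1) ->
    (forall r', (forall i, `|r' i| = 1) ->
      re (phase_sum M r' c) <= re (phase_sum M r c)) ->
  forall i, im (\sum_j r i * (c j * M i j)) = 0.
Proof.
move=> r1 rmax i; apply: Im0_of_Re_max => u u1.
pose r' k := if k == i then u * r i else r k.
have : re (phase_sum M r' c) <= re (phase_sum M r c).
  apply: rmax => k; rewrite /r'; case: eqVneq => // _.
  by rewrite normrM u1 r1 mulr1.
rewrite /phase_sum (bigD1 i)//= [in X in _ <= X](bigD1 i)//= !raddfD/=.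
rewrite [X in _ + X <= _](_ : _ = re (\sum_(k | k != i)
    \sum_j r k * (c j * M k j))); last first.
  by congr (re _); apply: eq_bigr => k /negPf ki; rewrite /r' ki.
rewrite lerD2r /r' eqxx (eq_bigr (fun j => u * (r i * (c j * M i j)))).
  by rewrite -mulr_sumr.
by move=> j _; rewrite -mulrA.
Qed.

Lemma gauge_fix n (M : 'M[Cplx R]_n) :
  exists r c : 'I_n -> Cplx R,
    [/\ forall i, `|r i| = 1, forall j, `|c j| = 1,
        forall i, im (\sum_j r i * (c j * M i j)) = 0,
        forall j, im (\sum_i r i * (c j * M i j)) = 0 &
        re (\sum_i \sum_j M i j)
        <= re (\sum_i \sum_j r i * (c j * M i j))].
Proof.
have [r [c [r1 c1 rcmax]]] := phase_sum_max M.
exists r, c; split=> //.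
- by apply: phase_sum_max_row => // r' r'1; exact: rcmax.
- move=> j.
  (* Columns are the rows of the transpose, with the roles of [r] and [c] exchanged. *)
  have := @phase_sum_max_row _ _ M^T c r c1 _ j.
  rewrite (eq_bigr (fun i => r i * (c j * M i j))); first apply.
    by move=> c' c'1; rewrite -!phase_sumC; exact: rcmax.
  by move=> i _; rewrite mxE mulrCA.
(* Comparison of the maximum with the trivial phases. *)
- have := rcmax (fun=> 1) (fun=> 1) (fun=> normr1 _) (fun=> normr1 _).
  rewrite [X in re X <= _](_ : _ = \sum_i \sum_j M i j)//.
  by apply: eq_bigr => i _; apply: eq_bigr => j _; rewrite !mul1r.
Qed.

End Phases.

(** * Real coordinates for tangent vectors and gauge directions *)

Section Infinitesimal.
Context {R : realType} {n : nat}.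
Implicit Types (H : 'M[R]_n.+1) (U E X Y : 'M[Cplx R]_n.+1).

(* Coordinates on the real vector space of antihermitian matrices, so that
   real dimensions can be counted in ['M[R]_n.+1]. *)
Definition antiherm H : 'M[Cplx R]_n.+1 :=
  \matrix_(i, j) ((H i j - H j i) +i* (H i j + H j i))%C.

(** In [antiherm H] the real part [H i j - H j i] and the imaginary part [H i j + H j i] add up to
    [2 * H i j]. *)
Definition antiherm_coord E : 'M[R]_n.+1 :=
  \matrix_(i, j) ((re (E i j) + im (E i j)) / 2).

Lemma antiherm_anti H : (antiherm H)^t* = - antiherm H.
Proof.
by apply/matrixP => i j; rewrite !mxE /Num.conj/=; congr Complex; ring.
Qed.

Lemma antiherm_coordK E : E^t* = - E -> antiherm (antiherm_coord E) = E.
Proof.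
move=> /matrixP Eanti; apply/matrixP => i j; have := Eanti i j.
rewrite !mxE; case: (E i j) (E j i) => a b [c d];
  rewrite /Num.conj/= => -[-> bd].
have -> : d = b by rewrite -[d]opprK bd opprK.
by congr Complex; field.
Qed.

Lemma antiherm_linear (a : R) H K :
  antiherm (a *: H + K) = (a%:C)%C *: antiherm H + antiherm K.
Proof.
by apply/matrixP => i j; rewrite !mxE/=; congr Complex; rewrite /=; ring.
Qed.

Lemma antiherm_coord_linear (a : R) X Y :
  antiherm_coord (((a%:C)%C : Cplx R) *: X + Y) =
  a *: antiherm_coord X + antiherm_coord Y.
Proof.
apply/matrixP => i j; rewrite !mxE.
by case: (X i j) (Y i j) => x1 x2 [y1 y2] /=; field.
Qed.

Definition dsq U H : 'M[R]_n.+1 := Dsqnorm_mx U (antiherm H *m U).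

Lemma dsq_is_linear U : linear (dsq U).
Proof.
move=> a H K; rewrite /dsq antiherm_linear mulmxDl -scalemxAl.
apply/matrixP => i j; rewrite !mxE.
by move: (U i j) (\sum_k _) (\sum_k _) => [u1 u2] [e1 e2] [f1 f2] /=; ring.
Qed.
HB.instance Definition _ U :=
  GRing.isLinear.Build R 'M[R]_n.+1 'M[R]_n.+1 _ (dsq U) (dsq_is_linear U).

(** The Lie algebra of the group of unitary diagonal matrices. *)
Definition phase_mx (x : 'rV[R]_n.+1) : 'M[Cplx R]_n.+1 :=
  diag_mx (\row_i (0 +i* x 0 i)%C).

(* The tangent vector i(D_a U + U D_b), with its generator in coordinates. *)
Definition gauge_dir U (ab : 'rV[R]_n.+1 * 'rV[R]_n.+1) : 'M[R]_n.+1 :=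
  antiherm_coord (phase_mx ab.1 + U *m phase_mx ab.2 *m U^t*).

Lemma phase_mx_linear (a : R) x y :
  phase_mx (a *: x + y) = ((a%:C)%C : Cplx R) *: phase_mx x + phase_mx y.
Proof.
apply/matrixP => i j; rewrite !mxE.
by case: eqP => _; rewrite ?mulr0n ?mulr1n/=; congr Complex; rewrite /=; ring.
Qed.

Lemma gauge_dir_is_linear U : linear (gauge_dir U).
Proof.
move=> a [x1 x2] [y1 y2]; rewrite -antiherm_coord_linear /gauge_dir/=;
  congr antiherm_coord.
rewrite !phase_mx_linear mulmxDr mulmxDl -scalemxAr -scalemxAl.
by rewrite scalerDr addrACA.
Qed.
HB.instance Definition _ U :=
  GRing.isLinear.Build R _ 'M[R]_n.+1 _ (gauge_dir U) (gauge_dir_is_linear U).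

Lemma phase_mx_anti x : (phase_mx x)^t* = - phase_mx x.
Proof.
apply/matrixP => i j; rewrite !mxE eq_sym; case: eqVneq => [->|_].
  by rewrite !mulr1n /Num.conj/=; congr Complex; rewrite oppr0.
by rewrite !mulr0n rmorph0 oppr0.
Qed.

Lemma conj_anti U E : E^t* = - E -> (U *m E *m U^t*)^t* = - (U *m E *m U^t*).
Proof.
move=> Eanti; rewrite !trmx_mul !map_mxM Eanti trmxCK.
by rewrite mulNmx mulmxN mulmxA.
Qed.

Lemma antiherm_gauge_dir U ab :
  antiherm (gauge_dir U ab) = phase_mx ab.1 + U *m phase_mx ab.2 *m U^t*.
Proof.
rewrite antiherm_coordK// linearD map_mxD/= conj_anti ?phase_mx_anti//.
by rewrite opprD.
Qed.

(** The relation [U^* U = 1] removes the conjugation. Each entry of [U] is multiplied by an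
    imaginary number, so moduli are stationary along gauge directions. *)
Lemma antiherm_gauge_dirM U ab : U \is unitarymx ->
  antiherm (gauge_dir U ab) *m U =
  \matrix_(i, j) ((0 +i* (ab.1 0 i + ab.2 0 j))%C * U i j).
Proof.
move=> /unitarymxP/mulmx1C UU;
  rewrite antiherm_gauge_dir mulmxDl -!mulmxA UU mulmx1.
apply/matrixP => i j; rewrite mxE mul_diag_mx mul_mx_diag !mxE.
by rewrite [X in _ + X]mulrC -mulrDl; congr (_ * _); congr Complex;
  rewrite /= addr0.
Qed.

End Infinitesimal.

(** * Image and kernel of the differential when the defect vanishes *)

Section Rigidity.
Context {R : realType} {n : nat}.
Implicit Types (H : 'M[R]_n.+1) (U E X Y : 'M[Cplx R]_n.+1).

Lemma anti_diag_re E i : E^t* = - E -> re (E i i) = 0.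
Proof.
move=> /matrixP/(_ i i); rewrite !mxE; case: (E i i) => a b.
rewrite /Num.conj/= => -[] aa; lra.
Qed.

(** The sum is twice the real part of a diagonal entry of [E U U^* = E], with [E] antihermitian. *)
Lemma dsq_row_sum U H i : U \is unitarymx -> \sum_j dsq U H i j = 0.
Proof.
move=> /unitarymxP UU.
transitivity (2 * re ((antiherm H *m U *m U^t*) i i)).
  rewrite mxE re_sum mulr_sumr; apply: eq_bigr => j _.
  by rewrite !mxE [in RHS](mulrC (\sum_k _)).
by rewrite -mulmxA UU mulmx1 anti_diag_re ?antiherm_anti// mulr0.
Qed.

(** Here the diagonal entry is one of [U^* E U], again antihermitian. *)
Lemma dsq_col_sum U H j : U \is unitarymx -> \sum_i dsq U H i j = 0.
Proof.
move=> UU.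
transitivity (2 * re ((U^t* *m antiherm H *m U) j j)).
  rewrite -mulmxA [in RHS]mxE re_sum mulr_sumr; apply: eq_bigr => i _.
  by rewrite !mxE.
rewrite anti_diag_re ?mulr0// -{2 4}[U]trmxCK.
by rewrite conj_anti ?antiherm_anti.
Qed.

Lemma dim_limg_dsq U : defect U = 0 ->
  \dim (limg (linfun (dsq U))) = (n ^ 2)%N.
Proof.
have [W WP ->] := defect_subspace U.
rewrite (_ : limg _ = W) ; last first.
  apply/vspaceP => M; apply/memv_imgP/idP => [[H _ ->]|/WP[_ [E /= Eanti <-]
    <-]].
    apply/WP; rewrite lfunE; exists (antiherm H *m U) => //.
    by exists (antiherm H) => //=; exact: antiherm_anti.
  by exists (antiherm_coord E); rewrite ?memvf// lfunE /= /dsq antiherm_coordK.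
by move=> /eqP; rewrite subr_eq0 subzn// subn1 expr2 -PoszM eqz_nat => /eqP.
Qed.

(** The zero line sums recover the deleted row and column from the minor. Hence matrices with zero
    line sums inject into the [n] by [n] matrices. *)
Lemma minor0_eq0 (M : 'M[R]_n.+1) i j :
    (forall i, \sum_j M i j = 0) -> (forall j, \sum_i M i j = 0) ->
  row' i (col' j M) = 0 -> M = 0.
Proof.
move=> rowM colM /matrixP M0.
have M0' k l : k != i -> l != j -> M k l = 0.
  rewrite eq_sym => /unlift_some[k' -> _];
    rewrite eq_sym => /unlift_some[l' -> _].
  by have := M0 k' l'; rewrite !mxE.
have M0j k : k != i -> M k j = 0.
  move=> ki; have := rowM k; rewrite (bigD1 j)//= big1 ?addr0// => l lj.
  exact: M0'.
apply/matrixP => k l; rewrite mxE.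
have [->{k}|ki] := eqVneq k i; last by have [->|lj] := eqVneq l j; auto.
have := colM l; rewrite (bigD1 i)//= big1 ?addr0// => k ki.
by have [->|lj] := eqVneq l j; auto.
Qed.

(** The image has dimension [n ^ 2] and injects into minors, so every minor is attained. One with a
    1 at position [(i, j)] is incompatible with [U i j = 0], since the derivative there carries the
    factor [(U i j)^*]. *)
Lemma entry_neq0 U i j : U \is unitarymx -> defect U = 0 -> U i j != 0.
Proof.
move=> Uu dU; apply/eqP => Uij.
(* In size 1 there is no other row to delete, but the single entry has modulus 1. *)
have [n0|n_gt0] := posnP n.
  have /unitarymxP/matrixP/(_ i i) := Uu.
  rewrite !mxE eqxx big1 => [/esym/eqP|k _]; first by rewrite oner_eq0.
  have -> : k = j by apply: ord_inj; move: (ltn_ord k) (ltn_ord j); lia.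
  by rewrite Uij mul0r.
have ex_neq (k : 'I_n.+1) : exists k' : 'I_n.+1, k' != k.
  have [->|] := eqVneq k ord0; last by exists ord0; rewrite eq_sym.
  by exists ord_max; rewrite -val_eqE/=; lia.
(* The deleted row [i0] and column [j0] avoid [(i, j)], which survives in the minor as
   [(i', j')]. *)
have [i0 i0i] := ex_neq i; have [j0 j0j] := ex_neq j.
have [i' iE _] := unlift_some i0i; have [j' jE _] := unlift_some j0j.
pose minor : 'Hom('M[R]_n.+1, 'M[R]_n) := linfun (row' i0 \o col' j0).
have minorK : (limg (linfun (dsq U)) :&: lker minor)%VS = 0%VS.
  apply/eqP; rewrite -subv0; apply/subvP => M /memv_capP[/memv_imgP[H _]].
  rewrite lfunE /= memv_ker lfunE /= => MH /eqP M0; rewrite memv0; apply/eqP.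
  by apply: minor0_eq0 M0 => k; rewrite MH;
    [exact: dsq_row_sum|exact: dsq_col_sum].
have /eqP minor_full : (minor @: limg (linfun (dsq U)))%VS == fullv.
  rewrite eqEdim subvf limg_dim_eq// dim_limg_dsq// dimvf dim_matrix -mulnn;
    exact: leqnn.
have := memvf (delta_mx i' j' : 'M[R]_n); rewrite -minor_full.
move=> /memv_imgP[_ /memv_imgP[H _ ->]];
  rewrite !lfunE /= => /matrixP/(_ i' j').
rewrite !mxE -iE -jE !eqxx Uij => /eqP.
by rewrite rmorph0 mul0r /= mulr0 oner_eq0.
Qed.

(** Gauge directions lie in the kernel, whose dimension is [(n + 1)^2 - n^2 = 2n + 1]. They are
    parametrized by [2n + 2] reals with at most one redundancy, so they fill it. *)
Lemma gauge_dir_ker U : U \is unitarymx -> defect U = 0 ->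
  lker (linfun (dsq U)) = limg (linfun (gauge_dir U)).
Proof.
move=> Uu dU; apply/eqP; rewrite eq_sym eqEdim; apply/andP; split.
  apply/subvP => _ /memv_imgP[ab _ ->]; rewrite memv_ker !lfunE/= /dsq.
  rewrite antiherm_gauge_dirM//; apply/eqP/matrixP => i j; rewrite !mxE.
  by case: (U i j) => x y /=; ring.
have := limg_ker_dim (linfun (dsq U)) fullv.
rewrite capfv dim_limg_dsq// dimvf dim_matrix.
have := limg_ker_dim (linfun (gauge_dir U)) fullv.
rewrite capfv dimvf [dim _](_ : _ = n.+1 + n.+1)%N; last first.
  by rewrite -[LHS]/(dim 'rV[R]_n.+1 + dim 'rV[R]_n.+1)%N dim_matrix -[LHS]/(1
    * n.+1 + 1 * n.+1)%N !mul1n.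
suff : (\dim (lker (linfun (gauge_dir U))) <= 1)%N by nia.
(* The redundancy is the global phase, which can be moved from the rows to the columns. *)
apply: (@leq_trans (\dim <[(const_mx 1, const_mx (- 1)) : 'rV[R]_n.+1 *
  'rV[R]_n.+1]>)).
  apply/dimvS/subvP => -[a b]; rewrite memv_ker lfunE/= => /eqP ab0.
  have abE i j : a 0 i + b 0 j = 0.
    have /matrixP/(_ i j) := antiherm_gauge_dirM (a, b) Uu.
    rewrite ab0 (_ : antiherm 0 = 0) ?mul0mx; last first.
      by apply/matrixP => k l; rewrite !mxE subrr addr0.
    rewrite !mxE => /esym/eqP;
      rewrite mulf_eq0 (negPf (entry_neq0 _ _ _ _))// orbF.
    by rewrite eq_complex /= => /andP[_ /eqP].
  apply/vlineP; exists (a 0 0); congr (_, _); apply/rowP => i; rewrite !mxE/=.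
    by have := abE i 0; have := abE 0 0; lra.
  by have := abE 0 i; lra.
by rewrite dim_vline leq_b1.
Qed.

(** The vanishing real parts make [E] a gauge direction with parameters [a] and [b]; the vanishing
    imaginary sums make it orthogonal to all gauge directions, hence to itself. *)
Lemma tangent_rigid U E :
    U \is unitarymx -> defect U = 0 -> E^t* = - E ->
    (forall i j, re ((U i j)^* * (E *m U) i j) = 0) ->
    (forall i, im (\sum_j (U i j)^* * (E *m U) i j) = 0) ->
    (forall j, im (\sum_i (U i j)^* * (E *m U) i j) = 0) ->
  E = 0.
Proof.
move=> Uu dU Eanti re0 row0 col0.
have : antiherm_coord E \in lker (linfun (dsq U)).
  rewrite memv_ker lfunE; apply/eqP/matrixP => i j.
  by rewrite /= /dsq antiherm_coordK// [LHS]mxE re0 mulr0 mxE.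
rewrite gauge_dir_ker// => /memv_imgP[[a b] _]; rewrite lfunE/= => Eab.
have EU i j : (E *m U) i j = (0 +i* (a 0 i + b 0 j))%C * U i j.
  by rewrite -[E]antiherm_coordK// Eab antiherm_gauge_dirM// mxE.
pose w i j := re (U i j) ^+ 2 + im (U i j) ^+ 2.
have w0 i j : 0 <= w i j by rewrite addr_ge0 ?sqr_ge0.
have imE i j : im ((U i j)^* * (E *m U) i j) = (a 0 i + b 0 j) * w i j.
  by rewrite EU /w; case: (U i j) => x y /=; ring.
(* Row condition [i] is weighted by [a 0 i], column condition [j] by [b 0 j], and all are added. *)
have sum0 : \sum_i \sum_j (a 0 i + b 0 j) ^+ 2 * w i j = 0.
  transitivity (\sum_i \sum_j a 0 i * ((a 0 i + b 0 j) * w i j)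
              + \sum_i \sum_j b 0 j * ((a 0 i + b 0 j) * w i j)).
    rewrite -big_split; apply: eq_bigr => i _; rewrite -big_split.
    by apply: eq_bigr => j _ /=; ring.
  rewrite [X in _ + X]exchange_big !big1 ?addr0// => i _; rewrite -mulr_sumr.
    rewrite (eq_bigr _ (fun k _ => esym (imE k i))) -im_sum.
    by rewrite col0 mulr0.
  rewrite (eq_bigr _ (fun k _ => esym (imE i k))) -im_sum.
  by rewrite row0 mulr0.
have EU0 : E *m U = 0.
  apply/matrixP => i j; rewrite EU mxE.
  have : (a 0 i + b 0 j) ^+ 2 * w i j == 0.
    have ge0 k l : 0 <= (a 0 k + b 0 l) ^+ 2 * w k l.
      by rewrite mulr_ge0 ?sqr_ge0.
    move/eqP: sum0; rewrite psumr_eq0 => [/allP/(_ i (mem_index_enum _))|k _].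
      by rewrite psumr_eq0// => /allP/(_ j (mem_index_enum _)).
    exact: sumr_ge0.
  rewrite mulf_eq0 sqrf_eq0 => /orP[/eqP ->|]; first by rewrite mul0r.
  rewrite /w paddr_eq0 ?sqr_ge0// !sqrf_eq0; case: (U i j) => x y /=.
  by case/andP => /eqP -> /eqP ->; rewrite mulr0.
by rewrite -[E]mulmx1 -(unitarymxP Uu) mulmxA EU0 mul0mx.
Qed.

End Rigidity.

(** * Entrywise bounds for linear maps and products *)

Local Notation "x %:C" := ((x%:C)%C : Cplx _) (only parsing) : ring_scope.

(** The argument is expanded in elementary matrices; [C] adds up the absolute entries of all their
    images. *)
Lemma lfun_mx_bounded (R : realFieldType) (m n p q : nat)
    (f : 'Hom('M[R]_(m, n), 'M[R]_(p, q))) :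
  exists2 C, 0 <= C & forall (M : 'M[R]_(m, n)) b,
    (forall i j, `|M i j| <= b) -> forall i j, `|f M i j| <= C * b.
Proof.
pose s k l := \sum_i \sum_j `|f (delta_mx k l) i j|.
have s0 k l : 0 <= s k l by apply: sumr_ge0 => i _; exact: sumr_ge0.
have le_s k l i j : `|f (delta_mx k l) i j| <= s k l.
  rewrite /s (bigD1 i)//= (bigD1 j)//= -addrA lerDl addr_ge0//.
    exact: sumr_ge0.
  by apply: sumr_ge0 => ? _; exact: sumr_ge0.
exists (\sum_k \sum_l s k l) => [|M b Mb i j].
  by apply: sumr_ge0 => k _; exact: sumr_ge0.
rewrite [M in f M]matrix_sum_delta linear_sum summxE mulr_suml.
apply: (le_trans (ler_norm_sum _ _ _)); apply: ler_sum => k _.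
rewrite linear_sum summxE mulr_suml.
apply: (le_trans (ler_norm_sum _ _ _)); apply: ler_sum => l _.
rewrite linearZ mxE normrM mulrC; apply: ler_pM => //; exact: le_s.
Qed.

Lemma mulmx_bounded (K : numDomainType) (m n p : nat) (A : 'M[K]_(m, n))
    (B : 'M[K]_(n, p)) a b :
    (forall i j, `|A i j| <= a) -> (forall i j, `|B i j| <= b) ->
  forall i j, `|(A *m B) i j| <= a * b *+ n.
Proof.
move=> Aa Bb i j; rewrite mxE; apply: (le_trans (ler_norm_sum _ _ _)).
apply: (@le_trans _ _ (\sum_(k < n) a * b)).
  by apply: ler_sum => k _; rewrite normrM ler_pM.
by rewrite sumr_const card_ord.
Qed.

Lemma mulr_le_of_sqr (K : numDomainType) (x y q : K) :
  0 <= x -> 0 <= y -> x ^+ 2 <= q -> y ^+ 2 <= q -> x * y <= q.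
Proof.
move=> x0 y0 xq yq.
case/orP: (real_leVge (ger0_real x0) (ger0_real y0)) => xy.
  by apply: le_trans yq; rewrite expr2 ler_wpM2r.
by apply: le_trans xq; rewrite expr2 ler_wpM2l.
Qed.

(** * The quadratic estimate for gauge-fixed matrices *)

Section Estimate.
Context {R : realType}.

Lemma normc_ge_Im (z : Cplx R) : `|im z|%:C <= `|z|.
Proof.
rewrite (normc_def z) lecR -sqrtr_sqr ler_wsqrtr// lerDr; exact: sqr_ge0.
Qed.

Lemma normc_le_ReDIm (z : Cplx R) : `|z| <= (`|re z| + `|im z|)%:C.
Proof.
rewrite (normc_def z) lecR -[leRHS]ger0_norm ?addr_ge0// -[leRHS]sqrtr_sqr
  ler_wsqrtr//.
rewrite sqrrD !real_normK ?num_real// addrAC lerDl mulrn_wge0// mulr_ge0//.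
Qed.

Context {n : nat}.
Implicit Types (H : 'M[R]_n.+1) (U V E X Y : 'M[Cplx R]_n.+1).

Lemma unitary_entry_le1 U i j : U \is unitarymx -> `|U i j| <= 1.
Proof.
move=> /unitarymxP/matrixP/(_ i i);
  rewrite !mxE eqxx -[true%:R]/(1 : Cplx R) => U1.
rewrite -(@expr_le1 _ 2)// -U1 (bigD1 j)//= !mxE -normCK lerDl sumr_ge0//.
by move=> k _; rewrite !mxE -normCK exprn_ge0.
Qed.

(* The linearized equations together with the gauge condition: X is a first
   order solution orthogonal to the gauge directions iff this matrix is 0. *)
Definition gauge_eqs U X : 'M[R]_(n.+1 + 1) :=
  block_mx (\matrix_(i, j) re ((U i j)^* * X i j))
           (\col_i im (\sum_j (U i j)^* * X i j))
           (\row_j im (\sum_i (U i j)^* * X i j)) 0.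

Lemma gauge_eqs_linear U (a : R) X Y :
  gauge_eqs U (a%:C *: X + Y) = a *: gauge_eqs U X + gauge_eqs U Y.
Proof.
have reE (z x y : Cplx R) :
    re (z^* * (a%:C * x + y)) = a * re (z^* * x) + re (z^* * y).
  by case: z x y => z1 z2 [x1 x2] [y1 y2] /=; ring.
have imE (z x y : Cplx R) :
    im (z^* * (a%:C * x + y)) = a * im (z^* * x) + im (z^* * y).
  by case: z x y => z1 z2 [x1 x2] [y1 y2] /=; ring.
rewrite /gauge_eqs scale_block_mx add_block_mx scaler0 addr0.
congr block_mx; apply/matrixP => i j; rewrite !mxE ?reE// !im_sum.
  by rewrite mulr_sumr -big_split; apply: eq_bigr => k _; rewrite !mxE imE.
by rewrite mulr_sumr -big_split; apply: eq_bigr => k _; rewrite !mxE imE.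
Qed.

Lemma gauge_eqsD U X Y : gauge_eqs U (X + Y) = gauge_eqs U X + gauge_eqs U Y.
Proof. by have := gauge_eqs_linear U 1 X Y; rewrite !scale1r. Qed.

Lemma gauge_eqs_bounded U X (b : Cplx R) : U \is unitarymx ->
    (forall i j, `|X i j| <= b) ->
  forall i j, `|gauge_eqs U X i j|%:C <= b *+ n.+1.
Proof.
move=> Uu Xb.
have b0 : 0 <= b by apply: le_trans (Xb 0 0).
have UXb i j : `|(U i j)^* * X i j| <= b.
  by rewrite normrM norm_conjC -[leRHS]mul1r ler_pM// unitary_entry_le1.
have sumb (F : 'I_n.+1 -> Cplx R) : (forall i, `|F i| <= b) ->
    `|im (\sum_i F i)|%:C <= b *+ n.+1.
  move=> Fb; apply: le_trans (normc_ge_Im _) _.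
  apply: le_trans (ler_norm_sum _ _ _) _.
  by apply: le_trans (ler_sum _ (fun i _ => Fb i)) _;
    rewrite sumr_const card_ord.
move=> i j; rewrite /gauge_eqs.
case: (split_ordP i) => k ->; case: (split_ordP j) => l ->.
- rewrite block_mxEul mxE; apply: le_trans (normc_ge_Re _) _.
  by apply: le_trans (UXb _ _) _; rewrite mulrS lerDl mulrn_wge0.
- by rewrite block_mxEur mxE; exact: sumb.
- by rewrite block_mxEdl mxE; exact: sumb.
- by rewrite block_mxEdr mxE normr0 mulrn_wge0.
Qed.

Definition gauge_eqs_antiherm U H := gauge_eqs U (antiherm H *m U).

Lemma gauge_eqs_antiherm_is_linear U : linear (gauge_eqs_antiherm U).
Proof.
move=> a H K; rewrite /gauge_eqs_antiherm antiherm_linear mulmxDl -scalemxAl.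
exact: gauge_eqs_linear.
Qed.
HB.instance Definition _ U := GRing.isLinear.Build R 'M[R]_n.+1
  'M[R]_(n.+1 + 1) _ (gauge_eqs_antiherm U) (gauge_eqs_antiherm_is_linear U).

Lemma antihermK : cancel (@antiherm R n) antiherm_coord.
Proof. by move=> H; apply/matrixP => i j; rewrite !mxE /=; field. Qed.

(** By [tangent_rigid] the linear system is injective, so in finite dimension it has a bounded left
    inverse. *)
Lemma gauge_eqs_coercive U : U \is unitarymx -> defect U = 0 ->
  exists2 C : Cplx R, 0 <= C & forall E, E^t* = - E ->
    forall b, (forall i j, `|gauge_eqs U (E *m U) i j|%:C <= b) ->
    forall i j, `|E i j| <= C * b.
Proof.
move=> Uu dU; pose f := linfun (gauge_eqs_antiherm U).
have ker0 : lker f == 0%VS.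
  rewrite -subv0; apply/subvP => H; rewrite memv_ker lfunE/= => /eqP.
  rewrite /gauge_eqs_antiherm /gauge_eqs -block_mx0 => /eq_block_mx[re0 row0
    col0 _].
  rewrite memv0 -[H]antihermK (@tangent_rigid _ _ U (antiherm H))//.
  - by apply/eqP/matrixP => i j; rewrite !mxE/= addr0 mul0r.
  - exact: antiherm_anti.
  - by move=> i j; have /matrixP/(_ i j) := re0; rewrite !mxE.
  - by move=> i; have /matrixP/(_ i 0) := row0; rewrite !mxE.
  - by move=> j; have /matrixP/(_ 0 j) := col0; rewrite !mxE.
have [C C0 fC] := lfun_mx_bounded f^-1%VF.
(* The real and imaginary parts of an entry of [antiherm H] each combine two entries of [H], giving
   four terms of size [C * b]. *)
exists (4 * C)%:C; first by rewrite lecR mulr_ge0.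
move=> E Eanti b fb i j.
have b_real : b = (re b)%:C.
  rewrite RRe_real//; apply: ger0_real.
  by apply: le_trans (fb 0 0); rewrite lecR.
have HC k l : `|antiherm_coord E k l| <= C * re b.
  rewrite -[antiherm_coord E](lker0_lfunK ker0); apply: fC => i' j'.
  rewrite lfunE/= /gauge_eqs_antiherm antiherm_coordK// -lecR.
  by rewrite -b_real.
apply: le_trans (normc_le_ReDIm _) _.
rewrite b_real -rmorphM lecR -[E]antiherm_coordK//.
have := ler_normB (antiherm_coord E i j) (antiherm_coord E j i).
have := ler_normD (antiherm_coord E i j) (antiherm_coord E j i).
have := HC i j; have := HC j i; rewrite !mxE /=; lra.
Qed.

(** Squared Frobenius distance, with values in [Cplx R] like the norm of that field. *)
Definition sqdist U V : Cplx R := \sum_i \sum_j `|V i j - U i j| ^+ 2.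

Lemma sqdist_ge0 U V : 0 <= sqdist U V.
Proof.
by apply: sumr_ge0 => i _; apply: sumr_ge0 => j _; exact: exprn_ge0.
Qed.

Lemma sqdist_eq0 U V : sqdist U V = 0 -> V = U.
Proof.
move=> /eqP; rewrite psumr_eq0 => [/allP V0|i _]; last first.
  by apply: sumr_ge0 => j _; exact: exprn_ge0.
apply/matrixP => i j; have := V0 i (mem_index_enum _);
  rewrite psumr_eq0 => [/allP|k _]; last first.
  exact: exprn_ge0.
by move=> /(_ j (mem_index_enum _));
  rewrite sqrf_eq0 normr_eq0 subr_eq0 => /eqP.
Qed.

(** All the equations hold for [V - U] up to second order, so coercivity gives [|W i j| <= K * q]
    with [q] the squared distance; squaring and summing yields the claim. *)
Lemma gauged_sqdist_le U : U \is unitarymx -> defect U = 0 ->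
  exists2 K : Cplx R, 0 <= K & forall V, V \is unitarymx ->
    (forall i j, `|V i j| = `|U i j|) ->
    (forall i, im (\sum_j (U i j)^* * V i j) = 0) ->
    (forall j, im (\sum_i (U i j)^* * V i j) = 0) ->
    sqdist U V <= K * sqdist U V ^+ 2.
Proof.
move=> Uu dU; have [C C0 coer] := gauge_eqs_coercive Uu dU.
pose N : Cplx R := n.+1%:R.
(* [C * (1 + N ^+ 3)] bounds the entries of [A] below, the factor [N] comes from multiplying by [U],
   and [N ^+ 2] bounds [S *m U], all in units of [q]. *)
pose K := C * (1 + N ^+ 3) * N + N ^+ 2.
have N0 : 0 <= N := ler0n _ _.
have K0 : 0 <= K by rewrite addr_ge0 ?mulr_ge0 ?addr_ge0 ?exprn_ge0.
exists (N ^+ 2 * K ^+ 2) => [|V Vu VU row0 col0];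
  first by rewrite mulr_ge0 ?exprn_ge0.
set q := sqdist U V; have q0 : 0 <= q := sqdist_ge0 U V.
pose W := V - U.
have Wq i j : `|W i j| ^+ 2 <= q.
  rewrite /q /sqdist (bigD1 i)//= (bigD1 j)//= !mxE -addrA lerDl addr_ge0//.
    by apply: sumr_ge0 => k _; exact: exprn_ge0.
  by apply: sumr_ge0 => k _; apply: sumr_ge0 => l _; exact: exprn_ge0.
(* Second order correction that makes [W U^*] exactly antihermitian. *)
pose S := 2^-1 *: (W *m W^t*).
have WWq i j : `|(W *m W^t*) i j| <= q *+ n.+1.
  rewrite mxE; apply: le_trans (ler_norm_sum _ _ _) _.
  apply: (@le_trans _ _ (\sum_(k < n.+1) q));
    last by rewrite sumr_const card_ord.
  apply: ler_sum => k _.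
  rewrite [(_ ^t*) k j]mxE [(_^T) k j]mxE normrM norm_conjC.
  exact: mulr_le_of_sqr.
have Sq i j : `|S i j| <= N * q.
  rewrite mxE normrM ger0_norm ?invr_ge0// mulr_natl.
  apply: le_trans (WWq i j); rewrite ler_piMl// invf_le1// ler1n.
  by [].
pose A := W *m U^t* + S.
have VE : V = W + U by rewrite subrK.
have Aanti : A^t* = - A.
  (* Difference of [V V^* = 1] and [U U^* = 1]. *)
  have WU0 : W *m W^t* = - (W *m U^t*) - (U *m W^t*).
    have := unitarymxP Vu; rewrite -(unitarymxP Uu) VE linearD map_mxD/=.
    rewrite mulmxDl !mulmxDr => /eqP; rewrite addrA -subr_eq0 addrK.
    by rewrite -addrA addr_eq0 opprD => /eqP.
  have Sh : S^t* = S.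
    rewrite /S linearZ map_mxZ/= trmx_mul map_mxM/= trmxCK; congr (_ *: _).
    by rewrite fmorphV/= rmorph_nat.
  have WUh : (W *m U^t*)^t* = U *m W^t* by rewrite trmx_mul map_mxM trmxCK.
  have SS : S + S = W *m W^t* by rewrite /S -scalerDl -div1r -splitr scale1r.
  apply/eqP; rewrite /A linearD map_mxD/= Sh WUh -addr_eq0 addrACA SS WU0.
  by rewrite -opprD [X in X - _]addrC subrr.
have UU : U^t* *m U = 1%:M by apply: mulmx1C; exact/unitarymxP.
have AU : A *m U = W + S *m U by rewrite mulmxDl -mulmxA UU mulmx1.
have SUq i j : `|(S *m U) i j| <= N ^+ 2 * q.
  apply: le_trans (mulmx_bounded Sq (fun i j => unitary_entry_le1 i j Uu) i j)
    _.
  by rewrite mulr1 -mulr_natl mulrA.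
(* Equal moduli give [re ((U i j)^* * W i j) = - |W i j|^2 / 2]; the imaginary sums vanish because
   [(U i j)^* * U i j] is real. *)
have WqE i j : `|gauge_eqs U W i j|%:C <= q.
  have imW (z w : Cplx R) : im (z^* * (w - z)) = im (z^* * w).
    by case: z w => z1 z2 [w1 w2] /=; ring.
  rewrite /gauge_eqs.
  case: (split_ordP i) => k ->; case: (split_ordP j) => l ->.
  - rewrite block_mxEul mxE; apply: le_trans (Wq k l).
    rewrite sqr_normE lecR !mxE.
    have := congr1 (fun z => z ^+ 2) (VU k l); rewrite !sqr_normE => -[].
    case: (V k l) (U k l) => v1 v2 [u1 u2] /= vu.
    have := sqr_ge0 (v1 - u1); have := sqr_ge0 (v2 - u2).
    by rewrite ler_norml !expr2 in vu *; move=> *; apply/andP; split; lra.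
  - rewrite block_mxEur mxE im_sum (eq_bigr (fun j => im ((U k j)^* * V k j))).
      by rewrite -im_sum row0 normr0.
    by move=> ? _; rewrite !mxE imW.
  - rewrite block_mxEdl mxE im_sum (eq_bigr (fun i => im ((U i l)^* * V i l))).
      by rewrite -im_sum col0 normr0.
    by move=> ? _; rewrite !mxE imW.
  - by rewrite block_mxEdr mxE normr0.
(* The 1 accounts for [W] and [N ^+ 3] for the correction [S *m U]. *)
have Aq i j : `|A i j| <= C * ((1 + N ^+ 3) * q).
  apply: coer => // k l; rewrite AU gauge_eqsD mxE.
  apply: (@le_trans _ _ (`|gauge_eqs U W k l|%:C + `|gauge_eqs U (S *m U) k
    l|%:C)).
    by rewrite -rmorphD lecR ler_normD.
  rewrite mulrDl mul1r lerD//.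
  apply: le_trans (gauge_eqs_bounded Uu SUq k l) _.
  by rewrite -mulr_natl mulrA -exprS.
have WK i j : `|W i j| <= K * q.
  have -> : W = A *m U - S *m U by rewrite AU addrK.
  rewrite [in leLHS]mxE [X in _ + X]mxE; apply: le_trans (ler_normB _ _) _.
  rewrite [leRHS]mulrDl lerD//.
  apply: le_trans (mulmx_bounded Aq (fun i j => unitary_entry_le1 i j Uu) i j)
    _.
  rewrite mulr1 -mulr_natl -/N [leLHS](_ : _ = C * (1 + N ^+ 3) * N * q)//;
    ring.
rewrite {1}/q /sqdist.
apply: (@le_trans _ _ (\sum_(i < n.+1) \sum_(j < n.+1) (K * q) ^+ 2)).
  apply: ler_sum => i _; apply: ler_sum => j _.
  by have := WK i j; rewrite !mxE; apply: lerXn2r; rewrite nnegrE ?mulr_ge0.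
by rewrite !sumr_const !card_ord -mulrnA -mulr_natl natrM exprMn mulrA -expr2.
Qed.

End Estimate.

(** * Unitary diagonal matrices as families of phases *)

Section UnitaryDiagonal.
Context {R : realType} {n : nat}.
Implicit Types (d : 'rV[Cplx R]_n) (D U : 'M[Cplx R]_n).

Lemma unitary_diagP D : unitary_diag D <->
  exists2 d : 'rV[Cplx R]_n, (forall i, `|d 0 i| = 1) & D = diag_mx d.
Proof.
split=> [/andP[/unitarymxP Du /diag_mxP[d DE]]|[d d1 ->]].
  exists d => // i; move: Du; rewrite DE tr_diag_mx map_diag_mx mulmx_diag.
  move=> /matrixP/(_ i i); rewrite !mxE eqxx mulr1n -normCK => /eqP.
  by rewrite sqrp_eq1// => /eqP.
apply/andP; split; last exact: diag_mx_is_diag.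
apply/unitarymxP; rewrite tr_diag_mx map_diag_mx mulmx_diag.
apply/matrixP => i j; rewrite !mxE; case: eqVneq => // ->.
by rewrite -normCK d1 expr1n.
Qed.

Lemma diag_mul_diagE d1 d2 U i j :
  (diag_mx d1 *m U *m diag_mx d2) i j = d1 0 i * U i j * d2 0 j.
Proof. by rewrite mul_mx_diag mxE mul_diag_mx mxE. Qed.

End UnitaryDiagonal.

(** With the moduli fixed only the cross term varies, so increasing the real part of the trace of
    [V U^*] decreases the distance. *)
Lemma sqdistE (R : realType) n (U V : 'M[Cplx R]_n.+1) :
    (forall i j, `|V i j| = `|U i j|) ->
  sqdist U V = (\sum_i \sum_j `|U i j| ^+ 2) *+ 2
             - (re (\sum_i \sum_j V i j * (U i j)^*) *+ 2)%:C.
Proof.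
move=> VU; rewrite re_sum -!sumrMnl rmorph_sum/= -sumrB.
apply: eq_bigr => i _; rewrite re_sum -!sumrMnl rmorph_sum/= -sumrB.
apply: eq_bigr => j _; rewrite mulr2n -{1}VU !sqr_normE -!rmorphD -rmorphB.
by case: (U i j) (V i j) => u1 u2 [v1 v2]/=; congr Complex; ring.
Qed.

(** * From the quadratic estimate to isolation *)

Section Isolation.
Context {R : realType} {n : nat}.
Implicit Types (U V : 'M[Cplx R]_n.+1).

(** After gauge fixing, [q <= K * q ^+ 2] forces [q = 0] or [K * q >= 1]; closeness to [U] excludes
    the latter. *)
Lemma gauge_equivalent U : U \is unitarymx -> defect U = 0 ->
  exists2 e : Cplx R, 0 < e & forall V, V \is unitarymx ->
    (forall i j, `|V i j| = `|U i j|) -> sqdist U V < e ->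
    exists Dr Dc, [/\ unitary_diag Dr, unitary_diag Dc & V = Dr *m U *m Dc].
Proof.
move=> Uu dU; have [K K0 gauged] := gauged_sqdist_le Uu dU.
have K1 : 0 < K + 1 by rewrite ltr_wpDl.
(* Adding 1 keeps the radius meaningful when [K = 0]. *)
exists (K + 1)^-1 => [|V Vu VU UV]; first by rewrite invr_gt0.
have [r [c [r1 c1 row0 col0 le_re]]] :=
  gauge_fix (\matrix_(i, j) (V i j * (U i j)^*)).
pose dr : 'rV_n.+1 := \row_i r i; pose dc : 'rV_n.+1 := \row_j c j.
have uDr : unitary_diag (diag_mx dr).
  by apply/unitary_diagP; exists dr => // i; rewrite mxE.
have uDc : unitary_diag (diag_mx dc).
  by apply/unitary_diagP; exists dc => // i; rewrite mxE.
pose V' := diag_mx dr *m V *m diag_mx dc.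
have V'E i j : V' i j = r i * V i j * c j by rewrite diag_mul_diagE !mxE.
have V'M i j : (U i j)^* * V' i j =
    r i * (c j * (\matrix_(i, j) (V i j * (U i j)^*)) i j).
  by rewrite V'E mxE; ring.
have V'U i j : `|V' i j| = `|U i j|.
  by rewrite V'E !normrM r1 c1 mul1r mulr1.
have V'u : V' \is unitarymx.
  case/andP: uDr uDc => uDr _ /andP[uDc _].
  by apply: mul_unitarymx uDc; exact: mul_unitarymx.
have V'_eq : V' = U.
  apply: sqdist_eq0.
  have leq : sqdist U V' <= sqdist U V.
    rewrite !sqdistE// lerD2l lerN2 lecR lerMn2r/=.
    have -> : \sum_i \sum_j V i j * (U i j)^* =
       \sum_i \sum_j (\matrix_(i, j) (V i j * (U i j)^*)) i j.
      by apply: eq_bigr => i _; apply: eq_bigr => j _; rewrite mxE.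
    apply: le_trans le_re _; rewrite le_eqVlt; apply/orP; left; apply/eqP.
    congr complex.Re; apply: eq_bigr => i _; apply: eq_bigr => j _.
    by rewrite -V'M mulrC.
  have : sqdist U V' <= K * sqdist U V' ^+ 2.
    apply: gauged => // k.
      by rewrite (eq_bigr _ (fun j _ => V'M k j)).
    by rewrite (eq_bigr _ (fun i _ => V'M i k)).
  have := sqdist_ge0 U V'; rewrite le_eqVlt => /orP[/eqP <-//|q0].
  rewrite expr2 mulrA -{1}[sqdist U V']mul1r ler_pM2r// => Kq.
  have : (K + 1) * sqdist U V' < 1.
    by rewrite -ltr_pdivlMl// mulr1; exact: le_lt_trans UV.
  move=> /lt_geF/negbT/negP[]; apply: le_trans Kq _.
  by rewrite mulrDl lerDl mul1r ltW.
(* The conjugate phases undo the gauge fixing. *)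
exists (diag_mx (map_mx Num.conj dr)), (diag_mx (map_mx Num.conj dc)); split.
- apply/unitary_diagP; exists (map_mx Num.conj dr) => // i.
  by rewrite !mxE norm_conjC.
- apply/unitary_diagP; exists (map_mx Num.conj dc) => // i.
  by rewrite !mxE norm_conjC.
- apply/matrixP => i j; rewrite diag_mul_diagE !mxE -V'_eq V'E.
  have rr : (r i)^* * r i = 1 by rewrite mulrC -normCK r1 expr1n.
  have cc : c j * (c j)^* = 1 by rewrite -normCK c1 expr1n.
  by rewrite !mulrA rr mul1r -mulrA cc mulr1.
Qed.

Lemma defect0_isolated U : U \is unitarymx -> defect U = 0 -> isolated_unitary
  U.
Proof.
move=> Uu dU; have [e e0 equiv] := gauge_equivalent Uu dU.
pose m : Cplx R := (n.+1 * n.+1)%:R.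
have m0 : 0 <= m := ler0n _ _.
exists [set V | sqdist U V < e].
  (* This choice ensures both [a <= 1], so that [a ^+ 2 <= a], and [m * a < e]. *)
  pose a := e / (m + 1 + e).
  have s0 : 0 < m + 1 + e by rewrite ltr_wpDl// addr_ge0.
  have a0 : 0 < a by rewrite divr_gt0.
  have a1 : a <= 1 by rewrite ler_pdivrMr// mul1r lerDr addr_ge0.
  apply: (filterS _ (nbhsx_ballx U a a0)) => V UV /=.
  apply: (@le_lt_trans _ _ (\sum_(i < n.+1) \sum_(j < n.+1) a)).
    apply: ler_sum => i _; apply: ler_sum => j _.
    have : `|U i j - V i j| < a by case: UV => _; exact.
    rewrite distrC => /ltW UVa; apply: le_trans (UVa).
    by rewrite expr2 ler_piMl//; exact: le_trans UVa a1.
  rewrite !sumr_const !card_ord -mulrnA -mulr_natl -/m.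
  by rewrite mulrA ltr_pdivrMr// mulrC ltr_pM2l// -addrA ltrDl ltr_pwDl// ltW.
apply/seteqP; split=> V [WV VU]; split=> //.
  by case: VU => Vu VU; exact: equiv.
case: VU => Dr [Dc [uDr uDc ->]]; split.
  case/andP: uDr uDc => uDr _ /andP[uDc _].
  by apply: mul_unitarymx uDc; exact: mul_unitarymx.
move: uDr uDc => /unitary_diagP[r r1 ->] /unitary_diagP[c c1 ->] i j.
by rewrite diag_mul_diagE !normrM r1 c1 mul1r mulr1.
Qed.

End Isolation.

Theorem theorem4p2 (R : realType) (N : nat) (U : 'M[Cplx R]_N)
    (U_unitary : U \is unitarymx) (defectU0 : defect U = 0) :
  isolated_unitary U.
Proof.
case: N U U_unitary defectU0 => [|n] U Uu dU; last exact: defect0_isolated.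
(* For [N = 0] the defect is [(0 - 1)^2 - 0 = 1], contradicting the hypothesis. *)
have [W _] := defect_subspace U; rewrite dU.
have := dimvS (subvf W); rewrite dimvf dim_matrix.
by case: (\dim W).
Qed.
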